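(* For a Hilbert space $\mathbb H$, the effect algebra $\mathcal E(\mathbb H)$ is homogeneous if and only if $\dim(\mathbb H)\le 1$.
   Context: An effect algebra is a partial algebra $(E;\oplus,0,1)$ with a partial binary operation $\oplus$ and two constants $0,1$ such that: (E1) if $a\oplus b$ is defined, then $b\oplus a$ is defined and $a\oplus b=b\oplus a$; (E2) if $a\oplus b$ and $(a\oplus b)\oplus c$ are defined, then $b\oplus c$ and $a\oplus(b\oplus c)$ are defined and $(a\oplus b)\oplus c=a\oplus(b\oplus c)$; (E3) for every $a\in E$ there is a unique $a'\in E$ with $a\oplus a'=1$; (E4) if $a\oplus 1$ is defined, then $a=0$. Write $a\le b$ iff there is $c\in E$ with $a\oplus c=b$; write $a\perp b$ iff $a\oplus b$ is defined. An effect algebra $E$ is homogeneous iff for all $u,v_1,v_2\in E$ such that $v_1\perp v_2$, $u\le v_1\oplus v_2$ and $u\le (v_1\oplus v_2)'$, there are $u_1,u_2\in E$ with $u_1\le v_1$, $u_2\le v_2$ and $u=u_1\oplus u_2$. For a Hilbert space $\mathbb H$, $\mathcal E(\mathbb H)$ is the set of all self-adjoint operators $A$ on $\mathbb H$ with $0\le A\le I$; for $A,B\in\mathcal E(\mathbb H)$, $A\oplus B$ is defined iff $A+B\le I$, and then $A\oplus B=A+B$. Then $(\mathcal E(\mathbb H),\oplus,0,I)$ is an effect algebra. *)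

(* Defs.v *)
From HB Require Import structures.
From mathcomp Require Import all_boot all_order all_algebra.
From mathcomp Require Import sesquilinear complex.
From mathcomp Require Import all_classical all_reals all_analysis.
Set Implicit Arguments.
Unset Strict Implicit.
Unset Printing Implicit Defensive.
Import Order.TTheory GRing.Theory Num.Theory.
Import numFieldNormedType.Exports.
Local Open Scope classical_set_scope.
Local Open Scope card_scope.
Local Open Scope ring_scope.

(* [oplus a b = None] means that the partial sum of a and b is undefined. *)
Record effectAlgebra := EffectAlgebra {
  ea_sort :> Type;
  oplus : ea_sort -> ea_sort -> option ea_sort;
  ea0 : ea_sort;
  ea1 : ea_sort;
  oplusC : forall a b c, oplus a b = Some c -> oplus b a = Some c;
  oplusA : forall a b c ab abc,
    oplus a b = Some ab -> oplus ab c = Some abc ->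
    exists2 bc, oplus b c = Some bc & oplus a bc = Some abc;
  oplus_ex1 : forall a, exists! a', oplus a a' = Some ea1;
  oplus_1 : forall a b, oplus a ea1 = Some b -> a = ea0
}.

Definition ea_le (E : effectAlgebra) (a b : E) : Prop :=
  exists c, oplus a c = Some b.

Definition ea_compl (E : effectAlgebra) (a : E) : E :=
  sval (cid (oplus_ex1 a)).

Definition homogeneous (E : effectAlgebra) : Prop :=
  forall u v1 v2 v : E, oplus v1 v2 = Some v ->
    ea_le u v -> ea_le u (ea_compl v) ->
    exists u1 u2 : E, [/\ ea_le u1 v1, ea_le u2 v2 & oplus u1 u2 = Some u].

(* Hilbert spaces over K with conjugation theta. The intended instances are
   K = R, theta = idfun (real) and K = R[i], theta = conjC (complex), for
   R : realType. The inner product is linear in its first argument. *)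
Record hilbertType (K : numFieldType) (theta : K -> K) := HilbertType {
  hilbert_sort :> completeNormedModType K;
  ip : {dot hilbert_sort for theta};
  ip_norm : forall x : hilbert_sort, `|x| ^+ 2 = ip x x
}.
Arguments ip {K theta} h.

Section Dimension.
Variables (K : numFieldType) (theta : K -> K) (H : hilbertType theta).

Definition orthonormal_set (B : set H) : Prop :=
  (forall x, B x -> ip H x x = 1) /\
  (forall x y, B x -> B y -> x <> y -> ip H x y = 0).

Definition hilbert_basis (B : set H) : Prop :=
  orthonormal_set B /\
  forall B' : set H, orthonormal_set B' -> B `<=` B' -> B' = B.

(* dim H is the common cardinality of all the orthonormal bases of H. *)
Definition hilbert_dim_le (n : nat) : Prop :=
  exists B : set H, hilbert_basis B /\ B #<= `I_n.

End Dimension.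

Section Effects.
Variables (K : numFieldType) (theta : {rmorphism K -> K}).
Variable H : hilbertType theta.
Implicit Types (A B : H -> H).

Lemma ip0l x : ip H 0 x = 0.
Proof. exact: linear0l. Qed.

Lemma ipDl x y z : ip H (x + y) z = ip H x z + ip H y z.
Proof. exact: linearDl. Qed.

Lemma ipDr x y z : ip H x (y + z) = ip H x y + ip H x z.
Proof. exact: linearDr. Qed.

Lemma ipBl x y z : ip H (x - y) z = ip H x z - ip H y z.
Proof. exact: linearBl. Qed.

Lemma ipBr x y z : ip H x (y - z) = ip H x y - ip H x z.
Proof. exact: linearBr. Qed.

(* Over R[i], [z <= w] in K entails that w - z is real. *)
Definition op_le A B : Prop := forall x, ip H (A x) x <= ip H (B x) x.

Definition self_adjoint A : Prop :=
  forall x y, ip H (A x) y = ip H x (A y).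

Record is_effect A : Prop := IsEffect {
  effect_linear : linear A;
  effect_continuous : continuous A;
  effect_self_adjoint : self_adjoint A;
  effect_ge0 : op_le \0 A;
  effect_le1 : op_le A idfun
}.

Definition effect : Type := {A : H -> H | is_effect A}.

Lemma effect_eq (a b : effect) : sval a =1 sval b -> a = b.
Proof.
case: a b => [A Aeff] [B Beff] /= /funext AB; case: B / AB Beff => Beff.
by congr exist; exact: Prop_irrelevance.
Qed.

Lemma is_effect0 : is_effect \0.
Proof.
split=> [c x y|x|x y|x|x] /=.
- by rewrite scaler0 addr0.
- exact: cst_continuous.
- by rewrite ip0l linear0r.
- by [].
- by rewrite ip0l -ip_norm exprn_ge0.
Qed.

Lemma is_effect1 : is_effect idfun.
Proof.
split=> [c x y|x|x y|x|x] //=.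
by rewrite ip0l -ip_norm exprn_ge0.
Qed.

Lemma is_effectD A B :
  is_effect A -> is_effect B -> op_le (A \+ B) idfun -> is_effect (A \+ B).
Proof.
move=> [lA cA sA A0 A1] [lB cB sB B0 B1] AB1; split=> //.
- by move=> c x y /=; rewrite lA lB scalerDr addrACA.
- by move=> x; apply: continuousD; [exact: cA|exact: cB].
- by move=> x y /=; rewrite ipDl ipDr sA sB.
- move=> x /=; rewrite ipDl.
  by apply: (le_trans (A0 x)); rewrite lerDl; have := B0 x; rewrite ip0l.
Qed.

Definition effect_oplus (a b : effect) : option effect :=
  if pselect (op_le (sval a \+ sval b) idfun) is left ab1
  then Some (exist _ _ (is_effectD (svalP a) (svalP b) ab1)) else None.

Definition effect0 : effect := exist _ _ is_effect0.
Definition effect1 : effect := exist _ _ is_effect1.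

Lemma effect_oplusP (a b c : effect) :
  effect_oplus a b = Some c <-> forall x, sval a x + sval b x = sval c x.
Proof.
rewrite /effect_oplus; case: pselect => [ab1|nab1]; split=> //.
- by move=> [<-].
- by move=> abc; congr Some; exact: effect_eq.
- move=> abc; exfalso; apply: nab1 => x /=.
  by rewrite abc; exact: (effect_le1 (svalP c)).
Qed.

Lemma effect_oplusC (a b c : effect) :
  effect_oplus a b = Some c -> effect_oplus b a = Some c.
Proof. by rewrite !effect_oplusP => + x => <-; rewrite addrC. Qed.

Lemma effect_oplusA (a b c ab abc : effect) :
  effect_oplus a b = Some ab -> effect_oplus ab c = Some abc ->
  exists2 bc, effect_oplus b c = Some bc & effect_oplus a bc = Some abc.
Proof.
rewrite !effect_oplusP => Eab Eabc.
have bc1 : op_le (sval b \+ sval c) idfun.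
  move=> x /=; apply: le_trans (effect_le1 (svalP abc) x).
  rewrite -Eabc -Eab -addrA [leRHS]ipDl lerDr.
  by have := effect_ge0 (svalP a) x; rewrite ip0l.
exists (exist _ _ (is_effectD (svalP b) (svalP c) bc1)).
- exact/effect_oplusP.
- by apply/effect_oplusP => x /=; rewrite -Eabc -Eab addrA.
Qed.

Lemma is_effectC A : is_effect A -> is_effect (fun x => x - A x).
Proof.
move=> [lA cA sA A0 A1]; split.
- by move=> c x y; rewrite lA scalerBr opprD addrACA.
- by move=> x; apply: continuousB; [exact: cvg_id|exact: cA].
- by move=> x y; rewrite ipBl ipBr sA.
- by move=> x /=; rewrite ip0l ipBl subr_ge0; exact: A1.
- move=> x /=; rewrite ipBl gerBl.
  by have := A0 x; rewrite ip0l.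
Qed.

Lemma effect_oplus_ex1 (a : effect) :
  exists! a', effect_oplus a a' = Some effect1.
Proof.
exists (exist _ _ (is_effectC (svalP a))); split.
  by apply/effect_oplusP => x /=; rewrite addrC subrK.
move=> b /effect_oplusP Eab; apply: effect_eq => x /=.
by rewrite -[x in x - _]Eab addrC addKr.
Qed.

Lemma effect_oplus_1 (a b : effect) :
  effect_oplus a effect1 = Some b -> a = effect0.
Proof.
move=> /effect_oplusP Eab; have [lA cA sA A0 A1] := svalP a.
set A := sval a in lA cA sA A0 A1 Eab.
have AD x y : A (x + y) = A x + A y by have := lA 1 x y; rewrite !scale1r.
have Axx x : ip H (A x) x = 0.
  apply/eqP; rewrite eq_le; apply/andP; split.
    have := effect_le1 (svalP b) x; rewrite -Eab /= ipDl.
    by rewrite gerDr.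
  by have := A0 x; rewrite ip0l.
apply: effect_eq => x /=; apply/eqP; rewrite -normr_eq0 -sqrf_eq0 ip_norm.
have := Axx (x + A x).
rewrite AD ipDl !ipDr !Axx /= add0r addr0 (sA (A x) x) -mulr2n.
by move=> /eqP; rewrite mulrn_eq0.
Qed.

Definition effect_algebra : effectAlgebra :=
  EffectAlgebra effect_oplusC effect_oplusA effect_oplus_ex1 effect_oplus_1.

End Effects.

(* Main.v *)
From HB Require Import structures.
Require Import Defs.
From mathcomp Require Import all_boot all_order all_algebra.
From mathcomp Require Import sesquilinear complex.
From mathcomp Require Import all_classical all_reals all_analysis.
Import Order.TTheory GRing.Theory Num.Theory.
Local Open Scope ring_scope.
Set Implicit Arguments.
Unset Strict Implicit.
Unset Printing Implicit Defensive.

(** Let [e1], [e2] be orthonormal in [H], and let [P], [Q] be the orthogonal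
    projections onto the lines of [e1] and of [e1 + e2]. Then
    [P / 2 + (I - P) / 2 = I / 2] is its own complement and dominates [Q / 2];
    yet [Q / 2] is not a sum [u1 + u2] of effects with [u1 <= P / 2] and
    [u2 <= (I - P) / 2]. Indeed an effect below another one vanishes wherever
    the latter does ([effect_le_ker]); so [u1] and [u2] both kill [e1 - e2]
    (as [Q] does), while [u1] kills [e2] and [u2] kills [e1]. Hence both kill
    [e1] and [e2], whereas [Q (e1 + e2) = e1 + e2 <> 0]. So
    if the effects are homogeneous, no orthonormal set has two elements
    ([homogeneous_orthonormal]), and a unit vector, if there is one, is by
    itself an orthonormal basis.

    Conversely, if an orthonormal basis has at most one element, then [H] is
    spanned by one vector, the quadratic form of an effect is determined by its
    value there, and these values are nonnegative, hence comparable: the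
    effects form a chain ([effect_total]). A chain is homogeneous
    ([total_homogeneous]): for [u <= v1 + v2], either [u <= v1] and
    [u = u + 0], or [v1 <= u] and [u = v1 + (u - v1)].

    Both directions hold over any numeric field with any conjugation for which
    the inner product induces the norm; the real and the complex statements are
    two instances. The projections are normalized by means of the norm itself,
    which takes its values in the field. *)

Section EffectAlgebra.
Import numFieldNormedType.Exports.
Local Open Scope classical_set_scope.
Local Open Scope card_scope.
Variables (K : numFieldType) (theta : {rmorphism K -> K}).
Variable H : hilbertType theta.
Implicit Types (A B : H -> H) (a b c : effect H) (x y e : H).

Local Notation "'<|' x , y '|>'" := (ip H x y) (format "'<|' x ,  y '|>'").

(** * Inner products, projections and scaling *)

Lemma ipZl k x y : <|k *: x, y|> = k * <|x, y|>.
Proof. exact: linearZl_LR. Qed.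

Lemma ipZr k x y : <|x, k *: y|> = theta k * <|x, y|>.
Proof. exact: linearZr_LR. Qed.

Lemma ip_sym x y : <|x, y|> = theta <|y, x|>.
Proof. by rewrite (hermC (ip H)) expr0 mul1r. Qed.

Lemma ip_ge0 x : 0 <= <|x, x|>.
Proof. by rewrite -ip_norm exprn_ge0. Qed.

Lemma ip_eq0 x : (<|x, x|> == 0) = (x == 0).
Proof. by rewrite -ip_norm sqrf_eq0 normr_eq0. Qed.

Lemma ip_normalize x : x != 0 -> <|`|x|^-1 *: x, `|x|^-1 *: x|> = 1.
Proof.
move=> x0; rewrite -ip_norm normrZ normfV normr_id mulVf ?expr1n//.
by rewrite normr_eq0.
Qed.

(** A self-adjoint idempotent satisfies [<A x, x> = |A x|^2] and
    [<x, x> - <A x, x> = |x - A x|^2]; the first gives positivity, the second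
    the upper bound, and together they give [|A x| <= |x|]. *)
Lemma is_effect_projection A :
  linear A -> self_adjoint A -> (forall x, A (A x) = A x) -> is_effect A.
Proof.
move=> lA sA AA.
have Axx x : <|A x, x|> = <|A x, A x|> by rewrite [RHS]sA AA -sA.
have A0 x : 0 <= <|A x, x|> by rewrite Axx ip_ge0.
have A1 x : <|A x, x|> <= <|x, x|>.
  rewrite -subr_ge0; have := ip_ge0 (x - A x).
  by rewrite ipBr !ipBl -Axx -sA subrr subr0.
split=> //; last by move=> x; rewrite /= ip0l.
pose f := HB.pack_for {linear H -> H} A (GRing.isLinear.Build _ _ _ _ A lA).
apply/(linear_bounded_continuous f)/bounded_funP => r; exists r => x xr.
apply: le_trans xr; rewrite -(ler_pXn2r (n := 2)) ?nnegrE//.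
by rewrite !ip_norm /= -Axx.
Qed.

Definition line_proj e x : H := <|x, e|> *: e.

Lemma is_effect_line_proj e : <|e, e|> = 1 -> is_effect (line_proj e).
Proof.
move=> e1; apply: is_effect_projection; rewrite /line_proj.
- by move=> k x y; rewrite ipDl ipZl scalerDl scalerA.
- by move=> x y; rewrite ipZl ipZr -ip_sym mulrC.
- by move=> x; rewrite ipZl e1 mulr1.
Qed.

Lemma is_effect_half A : is_effect A -> is_effect (2^-1 \*: A).
Proof.
move=> [lA cA sA A0 A1].
have A_ge0 x : 0 <= <|A x, x|> by have := A0 x; rewrite /= ip0l.
split.
- by move=> k x y; rewrite /= lA scalerDr !scalerA mulrC.
- by move=> x; apply: cvgZl_tmp; exact: cA.
- by move=> x y; rewrite /= ipZl ipZr sA fmorphV rmorph_nat.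
- by move=> x; rewrite /= ip0l ipZl mulr_ge0.
- move=> x; rewrite /= ipZl; apply: le_trans (A1 x).
  by rewrite ler_piMl// invf_le1// ler1n.
Qed.

Definition half a : effect H := exist _ _ (is_effect_half (svalP a)).

Lemma half_le a b :
  op_le (sval a) (sval b) -> op_le (sval (half a)) (sval (half b)).
Proof. by move=> ab x; rewrite !ipZl ler_pM2l// invr_gt0 ltr0n. Qed.

(** * The order of the effect algebra *)

Lemma effect_ip_ge0 a x : 0 <= <|sval a x, x|>.
Proof. by have := effect_ge0 (svalP a) x; rewrite /= ip0l. Qed.

Lemma effectD a x y : sval a (x + y) = sval a x + sval a y.
Proof. by have := effect_linear (svalP a) 1 x y; rewrite !scale1r. Qed.

Lemma effectx0 a : sval a 0 = 0.
Proof. by apply: (addrI (sval a 0)); rewrite -effectD !addr0. Qed.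

Lemma effectZ a k x : sval a (k *: x) = k *: sval a x.
Proof.
by have := effect_linear (svalP a) k x 0; rewrite effectx0 !addr0.
Qed.

(** The algebraic order is the order of quadratic forms: if [a <= b] as forms,
    then [b - a = I - (a + (I - b))], and complements and sums within the unit
    interval are effects. *)
Lemma effect_leP a b :
  @ea_le (effect_algebra H) a b <-> op_le (sval a) (sval b).
Proof.
split=> [[c /effect_oplusP abc] x|ab].
  by rewrite -abc ipDl lerDl effect_ip_ge0.
have aCb : op_le (sval a \+ (fun x => x - sval b x)) idfun.
  by move=> x; rewrite /= ipDl ipBl addrCA gerDl subr_le0.
have eff := is_effectC (is_effectD (svalP a) (is_effectC (svalP b)) aCb).
exists (exist _ _ eff); apply/effect_oplusP => x /=.
by rewrite opprD opprB addrCA addNKr addrC subrK.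
Qed.

(** If the form of [a] vanishes at [x], then its value at [x - a x], which is
    nonnegative, is [- 2 |a x|^2 + <a (a x), a x>]; by [a <= I] this is at most
    [- |a x|^2]. *)
Lemma effect_ip_eq0 a x : <|sval a x, x|> = 0 -> sval a x = 0.
Proof.
move=> axx; apply/eqP; rewrite -ip_eq0 eq_le ip_ge0 andbT.
have sa := effect_self_adjoint (svalP a).
have := effect_ip_ge0 a (x + -1 *: sval a x).
rewrite effectD effectZ ipDl !ipDr !ipZl !ipZr rmorphN1 axx add0r.
rewrite !mulN1r opprK.
rewrite (sa (sval a x) x) addrA -opprD addrC subr_ge0.
move=> h; have := le_trans h (effect_le1 (svalP a) (sval a x)).
by rewrite /= gerDl.
Qed.

Lemma effect_le_ker a b x :
  op_le (sval a) (sval b) -> sval b x = 0 -> sval a x = 0.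
Proof.
move=> ab bx0; apply: effect_ip_eq0; apply/eqP.
by rewrite eq_le effect_ip_ge0 andbT (le_trans (ab x))// bx0 ip0l.
Qed.

Lemma effect_complE a x :
  sval (@ea_compl (effect_algebra H) a) x = x - sval a x.
Proof.
rewrite /ea_compl; case: cid => b /= [/effect_oplusP /(_ x) /= abx _].
by rewrite -[X in X - _]abx addrC addKr.
Qed.

(** * Homogeneity fails for two orthonormal vectors *)

Lemma homogeneous_orthonormal (B : set H) x y :
  homogeneous (effect_algebra H) -> orthonormal_set B -> B x -> B y -> x = y.
Proof.
move=> homH [B1 B0] Bx By; apply: contrapT => xy.
have xx1 := B1 _ Bx; have yy1 := B1 _ By; have xy0 := B0 _ _ Bx By xy.
have yx0 : <|y, x|> = 0 by rewrite ip_sym xy0 rmorph0.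
pose g := x + y.
have g0 : g != 0.
  rewrite -ip_eq0 ipDl !ipDr xx1 yy1 xy0 yx0 addr0 add0r.
  by rewrite -(natrD _ 1 1) pnatr_eq0.
pose f := `|g|^-1 *: g.
have ff1 : <|f, f|> = 1 by exact: ip_normalize.
pose P : effect H := exist _ _ (is_effect_line_proj xx1).
pose P' : effect H := exist _ _ (is_effectC (svalP P)).
pose Q : effect H := exist _ _ (is_effect_line_proj ff1).
have Qxy : sval Q (x - y) = 0.
  rewrite /= /line_proj /f ipZr ipBl !ipDr xx1 yy1 xy0 yx0 addr0 add0r.
  by rewrite subrr mulr0 scale0r.
have Py : sval P y = 0 by rewrite /= /line_proj yx0 scale0r.
have P'x : sval P' x = 0 by rewrite /= /line_proj xx1 scale1r subrr.
have halfPP' : effect_oplus (half P) (half P') = Some (half (effect1 H)).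
  by apply/effect_oplusP => z; rewrite /= -scalerDr addrC subrK.
have Qle1 : op_le (sval (half Q)) (sval (half (effect1 H))).
  by apply: (@half_le Q (effect1 H)); exact: effect_le1 (svalP Q).
have compl_half z :
    sval (@ea_compl (effect_algebra H) (half (effect1 H))) z = 2^-1 *: z.
  rewrite effect_complE /= -[X in X - _]scale1r -scalerBl; congr (_ *: _).
  by rewrite [X in X - _](splitr 1) mul1r addrK.
have [|| u1 [u2 [u1P u2P' /effect_oplusP u12]]] :=
    homH (half Q) (half P) (half P') (half (effect1 H)) halfPP'.
- exact/effect_leP.
- by apply/effect_leP => z; rewrite compl_half; exact: Qle1.
move/effect_leP in u1P; move/effect_leP in u2P'.
(* Effects below [Q / 2] vanish at [x - y], which is orthogonal to [f]. *)
have kill (u : effect H) : op_le (sval u) (sval (half Q)) ->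
    sval u x = sval u y.
  move=> uQ; have : sval u (x - y) = 0.
    by apply: effect_le_ker uQ _; rewrite /= [line_proj _ _]Qxy scaler0.
  by rewrite effectD -scaleN1r effectZ scaleN1r => /subr0_eq.
have u1Q : op_le (sval u1) (sval (half Q)).
  by move=> z; rewrite -u12 ipDl lerDl effect_ip_ge0.
have u2Q : op_le (sval u2) (sval (half Q)).
  by move=> z; rewrite -u12 ipDl lerDr effect_ip_ge0.
have u1y : sval u1 y = 0.
  by apply: effect_le_ker u1P _; rewrite /= [line_proj _ _]Py scaler0.
have u2x : sval u2 x = 0.
  by apply: effect_le_ker u2P' _; rewrite /= [_ - _]P'x scaler0.
have : sval (half Q) f = 0.
  by rewrite -u12 !effectZ !effectD (kill _ u1Q) -(kill _ u2Q) u1y u2x !addr0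
             scaler0 addr0.
rewrite /= /line_proj ff1 scale1r => /eqP.
rewrite scaler_eq0 invr_eq0 pnatr_eq0 /= => /eqP f0.
by have := ff1; rewrite f0 ip0l => /eqP; rewrite eq_sym oner_eq0.
Qed.

(** * Chains of effects *)

Lemma total_homogeneous :
  (forall a b, op_le (sval a) (sval b) \/ op_le (sval b) (sval a)) ->
  homogeneous (effect_algebra H).
Proof.
move=> tot u v1 v2 v /effect_oplusP v12 /effect_leP uv _.
have [uv1|/effect_leP[w /effect_oplusP v1w]] := tot u v1.
  exists u, (effect0 H); split; first exact/effect_leP.
    by apply/effect_leP => x; rewrite /= ip0l effect_ip_ge0.
  by apply/effect_oplusP => x; rewrite /= addr0.
exists v1, w; split; [exact/effect_leP| |exact/effect_oplusP].
by apply/effect_leP => x; have := uv x; rewrite -v12 -v1w !ipDl lerD2l.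
Qed.

Lemma effect_total e : (forall x, exists k, x = k *: e) ->
  forall a b, op_le (sval a) (sval b) \/ op_le (sval b) (sval a).
Proof.
move=> span_e a b.
have le_e (c d : effect H) :
    <|sval c e, e|> <= <|sval d e, e|> -> op_le (sval c) (sval d).
  move=> cd x; have [k ->] := span_e x; rewrite !effectZ !ipZl !ipZr !mulrA.
  (* [k * theta k] is [|k e|^2 / |e|^2]. *)
  have [->|e0] := eqVneq e 0; first by rewrite !effectx0.
  apply: ler_wpM2l cd; have := ip_ge0 (k *: e).
  by rewrite ipZl ipZr mulrA pmulr_lge0// lt_def ip_eq0 e0 ip_ge0.
have /orP[ab|ba] := real_leVge (ger0_real (effect_ip_ge0 a e))
                               (ger0_real (effect_ip_ge0 b e)).
- by left; exact: le_e.
- by right; exact: le_e.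
Qed.

(** * Dimension at most one *)

(** Otherwise the normalized [x] could be added to the basis. *)
Lemma hilbert_basis_orthogonal (B : set H) x :
  hilbert_basis B -> (forall e, B e -> <|x, e|> = 0) -> x = 0.
Proof.
move=> [[B1 B0] Bmax] xB; apply/eqP; apply: contrapT => /negP x0.
pose f := `|x|^-1 *: x.
have fB e : B e -> <|f, e|> = 0 by move=> Be; rewrite ipZl xB// mulr0.
have ff1 : <|f, f|> = 1 by exact: ip_normalize.
have Bf : B f.
  rewrite -(Bmax (f |` B)); first by left.
    split=> [y [->//|/B1//]|y z [->|By] [->|Bz]] //; first by move=> _; exact: fB.
      by move=> _; rewrite ip_sym fB ?rmorph0.
    exact: B0.
  by move=> y By; right.
by have := fB f Bf; rewrite ff1 => /eqP; rewrite oner_eq0.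
Qed.

Lemma card_le1 (T : Type) (B : set T) (x y : T) :
  B #<= `I_1 -> B x -> B y -> x = y.
Proof.
move=> /card_leP[f] Bx By.
pose x' : B := exist _ x (mem_set Bx); pose y' : B := exist _ y (mem_set By).
suff /(congr1 val) : x' = y' by [].
apply: (@inj _ _ _ f); rewrite ?in_setT//; apply: val_inj.
have := set_valP (f x'); have := set_valP (f y').
by rewrite /= !ltnS !leqn0 => /eqP -> /eqP ->.
Qed.

Lemma hilbert_dim_le1_span :
  hilbert_dim_le H 1 -> exists e, forall x, exists k, x = k *: e.
Proof.
move=> [B [Bb B1]].
have [[e Be]|B0] := pselect (exists e, B e); last first.
  exists 0 => x; exists 0; rewrite scaler0.
  by apply: (hilbert_basis_orthogonal Bb) => e Be; case: B0; exists e.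
exists e => x; exists <|x, e|>; apply/eqP; rewrite -subr_eq0; apply/eqP.
apply: (hilbert_basis_orthogonal Bb) => e' Be'.
rewrite (card_le1 B1 Be' Be) ipBl ipZl.
by rewrite (proj1 (proj1 Bb) _ Be) mulr1 subrr.
Qed.

Lemma homogeneous_hilbert_dim_le1 :
  homogeneous (effect_algebra H) -> hilbert_dim_le H 1.
Proof.
move=> homH; have [[x x0]|H0] := pselect (exists x : H, x != 0).
  pose e := `|x|^-1 *: x; have ee1 : <|e, e|> = 1 by exact: ip_normalize.
  exists [set e]; split; last by rewrite (card_le_eql card_set1).
  split=> [|B' oB' eB']; first by split=> [y ->//|y z -> ->].
  have B'e : B' e by exact: eB'.
  apply/seteqP; split=> // y B'y.
  exact: homogeneous_orthonormal homH oB' B'y B'e.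
exists set0; split; last exact: card_ge0.
split=> // B' [B'1 _] _; apply/seteqP; split=> // y /B'1 yy1.
apply: H0; exists y; rewrite -ip_eq0 yy1; exact: oner_neq0.
Qed.

Lemma homogeneous_iff_hilbert_dim_le1 :
  homogeneous (effect_algebra H) <-> hilbert_dim_le H 1.
Proof.
split=> [|/hilbert_dim_le1_span[e span_e]].
  exact: homogeneous_hilbert_dim_le1.
exact: total_homogeneous (effect_total span_e).
Qed.

End EffectAlgebra.

Theorem corollary5p5 (R : realType) :
  (forall H : @hilbertType R idfun,
     homogeneous (effect_algebra H) <-> hilbert_dim_le H 1) /\
  (forall H : @hilbertType R[i] Num.conj,
     homogeneous (effect_algebra H) <-> hilbert_dim_le H 1).
Proof.
split=> H; exact: homogeneous_iff_hilbert_dim_le1.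
Qed.
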